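(* (Riordan Graph Decomposition) Let $G=G_n(g,f)$ be a Riordan graph of order $n$ with adjacency matrix $\mathcal{A}(G)$, and let $n_1=\lceil n/2\rceil$, $n_2=\lfloor n/2\rfloor$. Let $V_o$ and $V_e$ be the sets of odd and even labeled vertices of $G$, and let $P$ be the $n\times n$ permutation matrix $$P=\left(e_1,e_3,\ldots,e_{2n_1-1},e_2,e_4,\ldots,e_{2n_2}\right)^T,$$ where $e_i$ is the unit column vector with $1$ in the $i$th position. Then $$P\mathcal{A}(G)P^T=\begin{pmatrix} X & \tilde B\\ \tilde B^T & Y\end{pmatrix},$$ where $X=\mathcal{A}(\langle V_o\rangle)$, $Y=\mathcal{A}(\langle V_e\rangle)$, and (i) $\langle V_o\rangle$ is the Riordan graph of order $n_1$ corresponding to the Riordan matrix $\left(g'(\sqrt t),f(t)\right)$; (ii) $\langle V_e\rangle$ is the Riordan graph of order $n_2$ corresponding to the Riordan matrix $\left(\left(\frac{gf}{t}\right)'(\sqrt t),f(t)\right)$; (iii) $\tilde B=\mathcal{B}\left(t\,(gf)'(\sqrt t),f(t)\right)_{n_1\times n_2}+\mathcal{B}\left((tg)'(\sqrt t),f(t)\right)_{n_2\times n_1}^T$.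
   Context: Everything is modulo $2$. $[t^k]u$ is the coefficient of $t^k$ in $u$. For $u,v\in\mathbb{Z}[[t]]$ (or $\mathbb{Z}_2[[t]]$) with $v(0)=0$, $\mathcal{B}(u,v)_{p\times q}$ is the $p\times q$ $(0,1)$-matrix whose entry in row $i$ and column $j$ ($1\le i\le p$, $1\le j\le q$) is congruent mod $2$ to $[t^{i-1}]\,u v^{\,j-1}$. The Riordan graph $G_n(u,v)$ of order $n$ corresponding to the Riordan matrix $(u,v)$ is the simple graph on $[n]=\{1,\dots,n\}$ in which, for $i>j\ge1$, $i$ and $j$ are adjacent iff $[t^{i-2}]\,u v^{\,j-1}\equiv 1 \pmod 2$. For a power series $h$, the derivative $h'$ has mod $2$ only even powers of $t$, and $h'(\sqrt t)$ denotes the mod-$2$ power series $\sum_{k\ge0}\left([t^{2k+1}]h\right)t^k$. $\langle S\rangle$ is the subgraph induced by the vertex set $S$; the induced subgraphs $\langle V_o\rangle$ and $\langle V_e\rangle$ are viewed as labeled by $[n_1]$ and $[n_2]$ through $2k-1\mapsto k$ and $2k\mapsto k$, respectively. *)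

(* Defs.v *)
From HB Require Import structures.
From mathcomp Require Import all_boot all_order all_fingroup all_algebra.
From mathcomp Require Import zify.

Set Implicit Arguments.
Unset Strict Implicit.
Unset Printing Implicit Defensive.

Import GRing.Theory.
Local Open Scope ring_scope.

(* An element of Z[[t]], given by its coefficients.  A series over Z/2 is
   represented by its lift with coefficients 0 and 1; Riordan graphs and the
   matrices B(u,v) depend only on the coefficients modulo 2. *)
Definition fps := nat -> int.

Declare Scope fps_scope.
Delimit Scope fps_scope with fps.
Bind Scope fps_scope with fps.

Definition fps_one : fps := fun k => (k == 0%N)%:R.

Definition fps_t : fps := fun k => (k == 1%N)%:R.

Definition fps_mul (u v : fps) : fps :=
  fun k => \sum_(i < k.+1) u i * v (k - i)%N.

Definition fps_exp (u : fps) (m : nat) : fps := iter m (fps_mul u) fps_one.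

(* h / t, meaningful when h(0) = 0 (see fps_div_tK) *)
Definition fps_div_t (h : fps) : fps := fun k => h k.+1.

Definition fps_deriv (h : fps) : fps := fun k => h k.+1 *+ k.+1.

(* h'(sqrt t) modulo 2 (see fps_deriv_odd and fps_deriv_even) *)
Definition fps_deriv_sqrt (h : fps) : fps := fun k => (h k.*2.+1 %% 2)%Z.

Notation "u * v" := (fps_mul u v) : fps_scope.
Notation "u ^+ m" := (fps_exp u m) : fps_scope.

Lemma fps_mul_t (u : fps) (k : nat) :
  (fps_t * u)%fps k = if k is k'.+1 then u k' else 0.
Proof.
case: k => [|k]; rewrite /fps_mul /fps_t.
  by rewrite big_ord_recl big_ord0 mul0r addr0.
rewrite (bigD1 (Ordinal (isT : (1 < k.+2)%N))) //= mul1r subSS subn0.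
rewrite big1 ?addr0 // => i ni1.
by rewrite (_ : (i == 1%N :> nat) = false) ?mul0r //; exact: negbTE.
Qed.

Lemma fps_div_tK (h : fps) : h 0%N = 0 -> (fps_t * fps_div_t h)%fps =1 h.
Proof. by move=> h0 [|k]; rewrite fps_mul_t. Qed.

Lemma fps_deriv_odd (h : fps) (k : nat) :
  (fps_deriv h k.*2.+1 == 0 %[mod 2])%Z.
Proof. by rewrite /fps_deriv -mulr_natr; lia. Qed.

Lemma fps_deriv_even (h : fps) (k : nat) :
  (fps_deriv h k.*2 == fps_deriv_sqrt h k %[mod 2])%Z.
Proof. by rewrite /fps_deriv /fps_deriv_sqrt -mulr_natr; lia. Qed.

(* Rows and columns are indexed from 0: the exponents i - 1 and j - 1 of the
   1-based definition are the indices themselves. *)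
Definition riordan_mx (p q : nat) (u v : fps) : 'M[int]_(p, q) :=
  \matrix_(i < p, j < q) ((u * v ^+ j)%fps i %% 2)%Z.

(* Adjacency of the labels i > j >= 1 *)
Definition riordan_edge (u v : fps) (i j : nat) : bool :=
  ((u * v ^+ (j - 1))%fps (i - 2)%N == 1 %[mod 2])%Z.

(* A graph on [n] is a relation on 'I_n, where x : 'I_n has label x.+1. *)
Definition riordan_graph (n : nat) (u v : fps) : rel 'I_n :=
  fun x y => ((y < x)%N && riordan_edge u v x.+1 y.+1)
          || ((x < y)%N && riordan_edge u v y.+1 x.+1).

Lemma riordan_graph_sym (n : nat) (u v : fps) :
  symmetric (riordan_graph u v : rel 'I_n).
Proof. by move=> x y; rewrite /riordan_graph orbC. Qed.

Lemma riordan_graph_irr (n : nat) (u v : fps) :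
  irreflexive (riordan_graph u v : rel 'I_n).
Proof. by move=> x; rewrite /riordan_graph ltnn. Qed.

Definition adjacency_mx (n : nat) (e : rel 'I_n) : 'M[int]_n :=
  \matrix_(x, y) (e x y)%:R.

Definition induced (n : nat) (e : rel 'I_n) (S : {set 'I_n}) :
    rel {x | x \in S} :=
  fun x y => e (val x) (val y).
Arguments induced {n} e S x y.

Definition odd_vertices (n : nat) : {set 'I_n} := [set x : 'I_n | odd x.+1].

Definition even_vertices (n : nat) : {set 'I_n} := [set x : 'I_n | ~~ odd x.+1].

Lemma odd_vertex_lt (n : nat) (k : 'I_(uphalf n)) : (k.*2 < n)%N.
Proof. by have := ltn_ord k; lia. Qed.

Lemma even_vertex_lt (n : nat) (k : 'I_(n./2)) : (k.*2.+1 < n)%N.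
Proof. by have := ltn_ord k; lia. Qed.

Lemma odd_vertex_in (n : nat) (k : 'I_(uphalf n)) :
  Ordinal (odd_vertex_lt k) \in odd_vertices n.
Proof. by rewrite inE /= odd_double. Qed.

Lemma even_vertex_in (n : nat) (k : 'I_(n./2)) :
  Ordinal (even_vertex_lt k) \in even_vertices n.
Proof. by rewrite inE /= odd_double. Qed.

(* In terms of labels, k |-> 2k - 1 and k |-> 2k. *)
Definition odd_vertex (n : nat) (k : 'I_(uphalf n)) :
    {x | x \in odd_vertices n} :=
  Sub (Ordinal (odd_vertex_lt k)) (odd_vertex_in k).

Definition even_vertex (n : nat) (k : 'I_(n./2)) :
    {x | x \in even_vertices n} :=
  Sub (Ordinal (even_vertex_lt k)) (even_vertex_in k).

Lemma odd_vertex_bij (n : nat) : bijective (@odd_vertex n).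
Proof.
have lt (x : {x | x \in odd_vertices n}) : ((val (val x))./2 < uphalf n)%N.
  by case: x => x xo /=; move: xo (ltn_ord x); rewrite inE; lia.
exists (fun x => Ordinal (lt x)) => [k|x].
  by apply: val_inj; rewrite /= doubleK.
apply/val_inj/val_inj => /=.
by case: x => x xo /=; move: xo; rewrite inE; lia.
Qed.

Lemma even_vertex_bij (n : nat) : bijective (@even_vertex n).
Proof.
have lt (x : {x | x \in even_vertices n}) : ((val (val x))./2 < n./2)%N.
  by case: x => x xe /=; move: xe (ltn_ord x); rewrite inE; lia.
exists (fun x => Ordinal (lt x)) => [k|x].
  by apply: val_inj; rewrite /= uphalf_double.
apply/val_inj/val_inj => /=.
by case: x => x xe /=; move: xe; rewrite inE; lia.
Qed.

Definition odd_subgraph (n : nat) (e : rel 'I_n) : rel 'I_(uphalf n) :=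
  relpre (@odd_vertex n) (induced e (odd_vertices n)).

Definition even_subgraph (n : nat) (e : rel 'I_n) : rel 'I_(n./2) :=
  relpre (@even_vertex n) (induced e (even_vertices n)).

Definition unit_col (n : nat) (x : 'I_n) : 'cV[int]_n := delta_mx x 0.

(* The row index type is 'I_(n1 + n2) rather than 'I_n, so that the blocks are
   visible in the type; the two sizes are equal (odd_even_size). *)
Definition odd_even_mx (n : nat) : 'M[int]_(uphalf n + n./2, n) :=
  (row_mx (\matrix_(i, k) unit_col (val (@odd_vertex n k)) i 0)
          (\matrix_(i, k) unit_col (val (@even_vertex n k)) i 0))^T.

Lemma odd_even_size (n : nat) : (uphalf n + n./2)%N = n.
Proof. by lia. Qed.

Definition odd_even_index (n : nat) (i : 'I_n) : 'I_n :=
  match split (cast_ord (esym (odd_even_size n)) i) with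
  | inl k => val (odd_vertex k)
  | inr k => val (even_vertex k)
  end.

Lemma odd_even_index_inj (n : nat) : injective (@odd_even_index n).
Proof.
move=> i j; rewrite /odd_even_index.
case: splitP => k /= ik; case: splitP => l /= jl.
all: by move/(congr1 val) => /= kl; apply: val_inj => /=; lia.
Qed.

Lemma odd_even_mx_perm (n : nat) :
  is_perm_mx (castmx (odd_even_size n, erefl n) (odd_even_mx n)).
Proof.
apply/is_perm_mxP; exists (perm (@odd_even_index_inj n)).
apply/matrixP => i j; rewrite castmxE cast_ord_id !mxE permE /odd_even_index.
by case: split => k; rewrite !mxE eqxx andbT eq_sym.
Qed.

(* Main.v *)
Require Import Defs.
From mathcomp Require Import all_boot all_order all_algebra.
From mathcomp Require Import zify.

Set Implicit Arguments.
Unset Strict Implicit.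
Unset Printing Implicit Defensive.

Import GRing.Theory.
Local Open Scope ring_scope.

(** The block shape is bookkeeping: the odd-even permutation matrix selects the
    odd labels and then the even ones, so conjugating a symmetric matrix by it
    yields its four submatrices, the two off-diagonal ones being transposes of
    each other ([odd_even_mx_conj]).

    The arithmetic content is the single congruence [deriv_sqrt_mul_exp]: for
    every series h and all m, k,
    [t^(2k+1)] h f^(2m) = [t^k] h'(sqrt t) f^m modulo 2.
    It holds because squaring is the Frobenius endomorphism modulo 2, so that
    f(t)^(2m) = f^m(t^2); multiplying by a series in t^2 commutes with taking
    the odd part of h, and h'(sqrt t) is that odd part, re-indexed.

    In the graph, the exponent of f is the smaller label minus 1.  It is even,
    say 2m, when that label is odd; when it is even, one factor f is absorbed
    in g, leaving g f times an even power.  The exponent of t is the larger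
    label minus 2.  It is odd when that label is odd, and the congruence
    applies as it stands; otherwise it is shifted by one, either by multiplying
    the series by t (larger label even, smaller odd) or by dividing by t (both
    even), which is possible because (g f)(0) = 0.  The four parity
    combinations give the three parts of the theorem ([odd_edge], [even_edge],
    [odd_even_edge], [even_odd_edge]).

    Part (iii) is an equality of integer matrices, although each summand is
    only defined by reduction modulo 2.  No entry is nonzero in both summands:
    since f(0) = 0, the first vanishes unless the odd label exceeds the even
    one, and the second vanishes unless the even label exceeds the odd one
    ([fps_mul_exp_order]). *)

(** * Power series through polynomial truncations *)

(** Coefficients of a product below N depend only on the factors below N, so
    identities of power series can be read off from polynomials over any ring:
    the integers for exact identities, the field with two elements for
    congruences. *)
Definition fps_trunc (R : nzRingType) (N : nat) (u : fps) : {poly R} :=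
  \poly_(k < N) (u k)%:~R.

(** The polynomials are arbitrary lifts of the truncated series, not
    [fps_trunc] itself, so that the lemma can be iterated: a product of
    truncations is no longer a truncation. *)
Lemma coef_fps_mul (R : nzRingType) N (u v : fps) (p q : {poly R}) k :
    (forall i, (i < N)%N -> p`_i = (u i)%:~R) ->
    (forall i, (i < N)%N -> q`_i = (v i)%:~R) ->
  (k < N)%N -> (p * q)`_k = ((u * v)%fps k)%:~R.
Proof.
move=> pu qv kN; rewrite coefM /fps_mul raddf_sum /=.
apply: eq_bigr => i _; rewrite intrM pu ?qv //; have := ltn_ord i; lia.
Qed.

Lemma coef_fps_trunc (R : nzRingType) N (u : fps) k :
  (k < N)%N -> (fps_trunc R N u)`_k = (u k)%:~R.
Proof. by move=> kN; rewrite coef_poly kN. Qed.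

Lemma coef_fps_exp (R : nzRingType) N (u : fps) (p : {poly R}) m k :
    (forall i, (i < N)%N -> p`_i = (u i)%:~R) ->
  (k < N)%N -> (p ^+ m)`_k = ((u ^+ m)%fps k)%:~R.
Proof.
move=> pu; elim: m k => [|m IHm] k kN.
  by rewrite expr0 coef1 /fps_exp /= /fps_one; case: eqP.
by rewrite exprS (coef_fps_mul pu IHm).
Qed.

Lemma fps_mulA (u v w : fps) : (u * (v * w))%fps =1 (u * v * w)%fps.
Proof.
move=> k; rewrite -[LHS]intz -[RHS]intz.
have tr x i : (i < k.+1)%N -> (fps_trunc int k.+1 x)`_i = (x i)%:~R.
  exact: coef_fps_trunc.
have trM x y i ik := @coef_fps_mul _ _ _ _ _ _ i (tr x) (tr y) ik.
rewrite -(coef_fps_mul (tr u) (trM v w)) // mulrA.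
exact: coef_fps_mul (trM u v) (tr w) _.
Qed.

Lemma eq_fps_mull (u u' v : fps) : u =1 u' -> (u * v)%fps =1 (u' * v)%fps.
Proof. by move=> uu k; apply: eq_bigr => i _; rewrite uu. Qed.

Lemma fps_expS (u : fps) m : (u ^+ m.+1)%fps = (u * u ^+ m)%fps.
Proof. by []. Qed.

(** * Orders of vanishing at 0 *)

Lemma fps_mul_order (u v : fps) a b k :
    (forall i, (i < a)%N -> u i = 0) -> (forall i, (i < b)%N -> v i = 0) ->
  (k < a + b)%N -> (u * v)%fps k = 0.
Proof.
move=> u0 v0 kab; apply: big1 => i _.
case: (ltnP i a) => ia; first by rewrite u0 ?mul0r.
by rewrite v0 ?mulr0 //; have := ltn_ord i; lia.
Qed.

Lemma fps_exp_order (f : fps) m k :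
  f 0%N = 0 -> (k < m)%N -> (f ^+ m)%fps k = 0.
Proof.
move=> f0; elim: m k => // m IHm k km.
by apply: (@fps_mul_order _ _ 1%N m) IHm _ => // [[]].
Qed.

Lemma fps_mul_exp_order (u f : fps) m k :
  f 0%N = 0 -> (k < m)%N -> (u * f ^+ m)%fps k = 0.
Proof.
move=> f0 km; apply: (@fps_mul_order _ _ 0%N m) => // i; exact: fps_exp_order.
Qed.

(** * The odd part of a product with a square modulo 2 *)

(** The Frobenius endomorphism fixes the coefficients and squares 'X. *)
Lemma sqr_poly_F2 (p : {poly 'F_2}) : p ^+ 2 = p \Po 'X^2.
Proof.
elim/poly_ind: p => [|p c IHp]; first by rewrite comp_poly0 expr0n.
rewrite comp_polyD comp_polyM comp_polyX comp_polyC -IHp sqrrD exprMn.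
have -> : (p * 'X * c%:P) *+ 2 = 0.
  by rewrite -mulr_natr -polyC_natr pchar_Fp_0 // mulr0.
by rewrite addr0 -rmorphXn /=; congr (_ + _%:P); apply/val_inj; case: c => [[|[|]]].
Qed.

(** Multiplication by a polynomial in 'X^2 preserves the splitting of p into
    its even and odd parts. *)
Lemma odd_polyM_comp (R : comNzRingType) (p q : {poly R}) :
  odd_poly (p * (q \Po 'X^2)) = odd_poly p * q.
Proof.
rewrite -{1}[p]poly_even_odd mulrDl mulrAC -!comp_polyM odd_polyD odd_polyMX.
apply/polyP => i; rewrite coefD coef_odd_poly coef_even_poly.
by rewrite !coef_comp_poly_Xn // !dvdn2 /= odd_double /= add0r -muln2 mulnK.
Qed.

Lemma intr_F2 (x y : int) :
  (x%:~R == y%:~R :> 'F_2) = (x == y %[mod 2])%Z.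
Proof.
by rewrite -subr_eq0 -rmorphB /= -(dvdz_pcharf (pchar_Fp _)) // eqz_mod_dvd.
Qed.

(** The heart of the theorem: modulo 2, the even power of f is f^m(t^2), which
    passes through the extraction of odd coefficients as f^m. *)
Lemma deriv_sqrt_mul_exp (h f : fps) m k :
  ((h * f ^+ m.*2)%fps k.*2.+1 = (fps_deriv_sqrt h * f ^+ m)%fps k %[mod 2])%Z.
Proof.
apply/eqP; rewrite -intr_F2.
set N := k.*2.+2.
have tr x i : (i < N)%N -> (fps_trunc 'F_2 N x)`_i = (x i)%:~R.
  exact: coef_fps_trunc.
have trX l i := @coef_fps_exp _ _ _ _ l i (tr f).
rewrite -(coef_fps_mul (tr h) (trX m.*2)) // -coef_odd_poly.
rewrite -muln2 mulnC exprM sqr_poly_F2 -rmorphXn /= odd_polyM_comp.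
apply/eqP/(@coef_fps_mul _ k.+1) => // i ik; last by apply: trX; lia.
by rewrite coef_odd_poly tr; [apply/eqP; rewrite intr_F2 modz_mod | lia].
Qed.

(** Multiplying h by t moves its even coefficients to odd places. *)
Lemma deriv_sqrt_t_mul_exp (h f : fps) m k :
  ((h * f ^+ m.*2)%fps k.*2
    = (fps_deriv_sqrt (fps_t * h) * f ^+ m)%fps k %[mod 2])%Z.
Proof. by rewrite -deriv_sqrt_mul_exp -fps_mulA fps_mul_t. Qed.

(** * Edges by parity of the labels *)

(* The variables a and b below are indices starting from 0, standing for the
   labels 2a+1 (odd) or 2a+2 (even). *)

Lemma odd_edge (g f : fps) a b : (b < a)%N ->
  riordan_edge g f a.*2.+1 b.*2.+1 = riordan_edge (fps_deriv_sqrt g) f a.+1 b.+1.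
Proof.
case: a => // a _; rewrite /riordan_edge doubleS !subSS !subn0.
by rewrite deriv_sqrt_mul_exp.
Qed.

(** With g f = t h, the coefficient of t^(2a) in g f^(2b+1) is that of
    t^(2a-1) in h f^(2b), which has odd exponent. *)
Lemma even_edge (g f : fps) a b : f 0%N = 0 -> (b < a)%N ->
  riordan_edge g f a.*2.+2 b.*2.+2
  = riordan_edge (fps_deriv_sqrt (fps_div_t (g * f))) f a.+1 b.+1.
Proof.
case: a => // a f0 _; rewrite /riordan_edge doubleS !subSS !subn0.
rewrite fps_expS fps_mulA -deriv_sqrt_mul_exp.
have gf0 : (g * f)%fps 0%N = 0 by rewrite /fps_mul big_ord1 subnn f0 mulr0.
by rewrite -(eq_fps_mull _ (fps_div_tK gf0)) -fps_mulA fps_mul_t.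
Qed.

(** The factor t on the right compensates for the exponent of t, which is a - 1
    rather than a because the larger label is 2a+1. *)
Lemma odd_even_edge (g f : fps) a b : (b < a)%N ->
  riordan_edge g f a.*2.+1 b.*2.+2
  = ((fps_t * fps_deriv_sqrt (g * f) * f ^+ b)%fps a == 1 %[mod 2])%Z.
Proof.
case: a => // a _; rewrite /riordan_edge doubleS !subSS !subn0.
by rewrite fps_expS fps_mulA deriv_sqrt_mul_exp -fps_mulA fps_mul_t.
Qed.

Lemma even_odd_edge (g f : fps) a b :
  riordan_edge g f b.*2.+2 a.*2.+1
  = ((fps_deriv_sqrt (fps_t * g) * f ^+ a)%fps b == 1 %[mod 2])%Z.
Proof. by rewrite /riordan_edge !subSS !subn0 deriv_sqrt_t_mul_exp. Qed.

(** * Conjugation by the odd-even permutation *)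

Definition odd_even_block n (e : rel 'I_n) : 'M[int]_(uphalf n, n./2) :=
  \matrix_(a, b) (e (val (odd_vertex a)) (val (even_vertex b)))%:R.

Lemma odd_even_mxE n :
  odd_even_mx n = col_mx (rowsub (fun k => val (odd_vertex k)) 1%:M)
                         (rowsub (fun k => val (even_vertex k)) 1%:M).
Proof.
rewrite /odd_even_mx tr_row_mx.
by congr col_mx; apply/matrixP => i j; rewrite !mxE eqxx andbT eq_sym.
Qed.

Lemma selection_mx_conj (R : pzRingType) p q n (s : 'I_p -> 'I_n)
    (s' : 'I_q -> 'I_n) (A : 'M[R]_n) :
  rowsub s 1%:M *m A *m (rowsub s' 1%:M)^T = mxsub s s' A.
Proof.
by rewrite trmx_mxsub trmx1 mul_rowsub_mx mul1mx -mxsub_mul mulmx1.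
Qed.

Lemma odd_even_mx_conj n (e : rel 'I_n) : symmetric e ->
  odd_even_mx n *m adjacency_mx e *m (odd_even_mx n)^T
  = block_mx (adjacency_mx (odd_subgraph e)) (odd_even_block e)
             (odd_even_block e)^T (adjacency_mx (even_subgraph e)).
Proof.
move=> sym_e; rewrite odd_even_mxE mul_col_mx tr_col_mx mul_col_row.
rewrite !selection_mx_conj.
by congr block_mx; apply/matrixP => i j; rewrite !mxE // sym_e.
Qed.

Theorem theorem3p4 (n : nat) (g f : fps) (f0 : f 0%N = 0) :
  let n1 := uphalf n in
  let n2 := n./2 in
  let G : rel 'I_n := riordan_graph g f in
  let P := odd_even_mx n in
  let X := adjacency_mx (odd_subgraph G) in
  let Y := adjacency_mx (even_subgraph G) in
  exists B : 'M[int]_(n1, n2),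
    [/\ P *m adjacency_mx G *m P^T = block_mx X B B^T Y,
        odd_subgraph G =2 riordan_graph (fps_deriv_sqrt g) f,
        even_subgraph G =2 riordan_graph (fps_deriv_sqrt (fps_div_t (g * f))) f &
        B = riordan_mx n1 n2 (fps_t * fps_deriv_sqrt (g * f)) f
            + (riordan_mx n2 n1 (fps_deriv_sqrt (fps_t * g)) f)^T].
Proof.
move=> n1 n2 G P X Y; exists (odd_even_block G); split.
- exact/odd_even_mx_conj/riordan_graph_sym.
- move=> a b; rewrite /odd_subgraph /induced /G /riordan_graph /= !ltn_double.
  by case: ltngtP => //= ab; rewrite odd_edge.
- move=> a b; rewrite /even_subgraph /induced /G /riordan_graph /=.
  rewrite !ltnS !ltn_double.
  by case: ltngtP => //= ab; rewrite even_edge.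
apply/matrixP => a b; rewrite !mxE /G /riordan_graph /=.
(* Entry (a, b) concerns the labels 2a+1 and 2b+2; the larger is the odd one
   exactly when b < a. *)
have parity (x : int) : ((x == 1 %[mod 2])%Z)%:R = (x %% 2)%Z by lia.
have [ba|ab] := ltnP b a.
  have -> : (b.*2.+1 < a.*2)%N = true by lia.
  have -> : (a.*2 < b.*2.+1)%N = false by lia.
  rewrite orbF odd_even_edge // parity.
  by rewrite [X in _ = _ + (X %% 2)%Z]fps_mul_exp_order // mod0z addr0.
have -> : (b.*2.+1 < a.*2)%N = false by lia.
have -> : (a.*2 < b.*2.+1)%N = true by lia.
rewrite even_odd_edge parity -fps_mulA fps_mul_t.
case: (nat_of_ord a) ab => [|k] kb; first by rewrite mod0z add0r.
by rewrite [X in _ = (X %% 2)%Z + _]fps_mul_exp_order // mod0z add0r.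
Qed.
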